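(* Let $r,z\ge 1$ and $k\ge 3$ be integers. The excess $\epsilon$ of a totally regular $(r,z,k;+\epsilon)$-graph satisfies $$\epsilon \geq \frac{r}{\phi}\left[\frac{\lambda_1^{k-1}-1}{\lambda_1-1}-\frac{\lambda_2^{k-1}-1}{\lambda_2-1}\right],$$ where $\phi=\sqrt{(r+z-1)^2+4z}$, $\lambda_1=\frac12(r+z-1+\phi)$ and $\lambda_2=\frac12(r+z-1-\phi)$.
   Context: A (finite) mixed graph $G$ consists of a vertex set $V(G)$, a set of undirected edges and a set of directed arcs (ordered pairs of vertices). Loops are forbidden, as are parallel edges and arcs. Write $u\sim v$ if there is an edge between $u$ and $v$, and $u\to v$ if there is an arc from $u$ to $v$. The undirected degree $d(u)$ is the number of edges incident with $u$; the directed out-degree $d^+(u)$ (in-degree $d^-(u)$) is the number of arcs with initial (terminal) vertex $u$. $G$ is totally regular if there are $r,z$ with $d(u)=r$ and $d^+(u)=d^-(u)=z$ for all vertices $u$. A walk of length $\ell$ from $u_0$ to $u_\ell$ is a sequence $u_0u_1\dots u_\ell$ of vertices such that for each $0\le i\le \ell-1$ either $u_i\sim u_{i+1}$ or $u_i\to u_{i+1}$. A mixed path is a non-backtracking walk, i.e. a walk that never traverses an edge and then immediately retraces it (no $u_i\sim u_{i+1}\sim u_i$); walks of length $0$ are allowed. $G$ is $k$-geodetic if for every ordered pair $(u,v)$ of (not necessarily distinct) vertices there is at most one mixed path from $u$ to $v$ of length $\le k$. The mixed Moore bound $M(r,z,k)$ is the number of vertices of the mixed Moore tree of depth $k$: $M(r,z,k)=1+\sum_{t=1}^{k}(E_t+D_t)$,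 where $E_1=r$, $D_1=z$, $E_{t+1}=(r-1)E_t+rD_t$ and $D_{t+1}=z(E_t+D_t)$. An $(r,z,k;+\epsilon)$-graph is a $k$-geodetic mixed graph with minimum undirected degree $r$, minimum directed out-degree $z$ and order $M(r,z,k)+\epsilon$; $\epsilon$ is its excess. *)

(* Defs.v *)
From mathcomp Require Import all_boot all_order all_algebra.

Set Implicit Arguments.
Unset Strict Implicit.
Unset Printing Implicit Defensive.

(* Parallel edges and parallel arcs are excluded because [edge] and [arc] are
   relations, and an edge parallel to an arc by [edge_arcN]; since [edge] is
   symmetric, this covers both orientations of the arc. *)
Record mixedGraph := MixedGraph {
  vertex :> finType;
  edge : rel vertex;
  arc : rel vertex;
  edge_sym : symmetric edge;
  edge_irr : irreflexive edge;
  arc_irr : irreflexive arc;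
  edge_arcN : forall u v : vertex, edge u v -> ~~ arc u v
}.

Section MixedGraphTheory.

Variable G : mixedGraph.
Implicit Types (u v : G) (p q : seq G).

Definition udeg u : nat := #|[set v | edge u v]|.
Definition outdeg u : nat := #|[set v | arc u v]|.
Definition indeg u : nat := #|[set v | arc v u]|.

Definition totally_regular : Prop :=
  exists r z : nat, forall u, [/\ udeg u = r, outdeg u = z & indeg u = z].

Definition step : rel G := [rel u v | edge u v || arc u v].

(* A walk u_0 u_1 ... u_l is the sequence u_0 :: p, so its length is
   [size p]. *)
Definition walk u p v : bool := path step u p && (last u p == v).

Definition nonbacktracking (w : seq G) : bool :=
  [forall x, forall y, infix [:: x; y; x] w ==> ~~ edge x y].

Definition mixed_path u p v : bool := walk u p v && nonbacktracking (u :: p).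

Definition geodetic (k : nat) : Prop :=
  forall u v p q, mixed_path u p v -> mixed_path u q v ->
    size p <= k -> size q <= k -> p = q.

Definition is_minimum (f : G -> nat) (m : nat) : Prop :=
  (forall u, m <= f u) /\ (exists u, f u = m).

End MixedGraphTheory.

(* The pair (E_{t+1}, D_{t+1}) of the numbers of vertices at depth t + 1 of the
   mixed Moore tree that are joined to their parent by an edge, respectively
   an arc. *)
Fixpoint moore_level (r z t : nat) : nat * nat :=
  if t is t'.+1 then
    let: (E, D) := moore_level r z t' in (r.-1 * E + r * D, z * (E + D))
  else (r, z).

Definition moore_bound (r z k : nat) : nat :=
  1 + \sum_(t < k) ((moore_level r z t).1 + (moore_level r z t).2).

(* The excess is an integer, so that the Moore bound #|G| >= M(r,z,k) is not
   part of the definition. *)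
Definition excess_graph (r z k : nat) (eps : int) (G : mixedGraph) : Prop :=
  [/\ geodetic G k,
      is_minimum (@udeg G) r,
      is_minimum (@outdeg G) z
    & (#|G|%:Z = (moore_bound r z k)%:Z + eps)%R].

(* Main.v *)
Require Import Defs.
From mathcomp Require Import all_boot all_order all_algebra.
From mathcomp Require Import zify ring.
Import Order.TTheory GRing.Theory Num.Theory.
Local Open Scope ring_scope.

(** Fix a vertex u and its z out-neighbours v_1, ..., v_z.  By k-geodecity and
    regularity each v_i reaches exactly M(r,z,k) vertices by mixed paths of
    length at most k, so it misses exactly epsilon vertices.

    Let y be the end of a mixed path from u that begins with an edge and has
    length between 1 and k - 2, and let y -> x.  Some v_i misses x.  Otherwise
    look at the last step of a path from each v_i to x; there is one, since
    v_i = x would give u two mixed paths to x.  It is not an edge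
    w ~ x, for then u would have two mixed paths of length at most k to w, one
    going through v_i and the other through y and x, the latter not
    backtracking because x is entered by an arc.  So it is an arc w_i -> x.
    The vertices w_1, ..., w_z and y are the ends of mixed paths of length at
    most k from u that have pairwise distinct second vertices, so they are
    pairwise distinct; but then x has in-degree at least z + 1.  This is
    [arc_child_unreached].

    Geodecity makes the vertices x as numerous as the paths u...yx.  The
    mixed paths of a given length t that begin with an edge are as numerous
    as those that end with one, namely E_t, so there are z (E_1 + ... +
    E_(k-2)) vertices x.  Each is among the at most z epsilon vertices missed
    by the v_i, and dividing by z gives epsilon >= E_1 + ... + E_(k-2), which
    is [moore_bound_excess].

    Finally E_t = r (lambda1^t - lambda2^t) / phi, because E satisfies the
    linear recurrence whose characteristic roots are lambda1 and lambda2;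
    summing two geometric series, as in [sum_moore_edges], gives the stated
    bound. *)

(** * Mixed paths with a remembered last edge *)

Section MixedPaths.
Local Open Scope nat_scope.
Set Implicit Arguments.
Unset Strict Implicit.

Variable G : mixedGraph.
Local Notation arc := (@Defs.arc G).
Implicit Types (o : option G) (u v w x y a : G) (p q : seq G).

(** The non-backtracking condition only needs to know the vertex, if any, from
    which the current vertex was entered by an edge.  Carrying it along as
    [o : option G] turns mixed paths into a structural recursion on the list
    of vertices. *)
Definition step_after o u v := edge u v && (o != Some v) || arc u v.

Definition edge_source u v : option G := if edge u v then Some u else None.

Fixpoint mixed_after o u p : bool :=
  if p is v :: p' then
    step_after o u v && mixed_after (edge_source u v) v p'
  else true.

Fixpoint final_source o u p : option G :=
  if p is v :: p' then final_source (edge_source u v) v p' else o.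

Lemma edge_source_arc u v : arc u v -> edge_source u v = None.
Proof.
rewrite /edge_source; case: ifP => // uv auv.
by have := edge_arcN uv; rewrite auv.
Qed.

Lemma mixed_after_cat o u p q :
  mixed_after o u (p ++ q)
  = mixed_after o u p && mixed_after (final_source o u p) (last u p) q.
Proof. by elim: p o u => //= v p IHp o u; rewrite IHp andbA. Qed.

Lemma mixed_after_cons_edge o u v p : o != Some v ->
  edge u v -> mixed_after (Some u) v p -> mixed_after o u (v :: p).
Proof. by move=> ov uv vp; rewrite /= /step_after /edge_source uv ov. Qed.

Lemma mixed_after_cons_arc o u v p :
  arc u v -> mixed_after None v p -> mixed_after o u (v :: p).
Proof. by move=> uv vp; rewrite /= /step_after uv orbT edge_source_arc. Qed.

Lemma mixed_after_rcons_arc o u p x :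
  mixed_after o u p -> arc (last u p) x -> mixed_after o u (rcons p x).
Proof.
by move=> up px; rewrite -cats1 mixed_after_cat up mixed_after_cons_arc.
Qed.

Lemma mixed_after_rcons_arc_edge o u p x w :
  mixed_after o u p -> arc (last u p) x -> edge x w ->
  mixed_after o u (rcons (rcons p x) w).
Proof.
move=> up px xw; rewrite -!cats1 -catA mixed_after_cat up.
by rewrite mixed_after_cons_arc // mixed_after_cons_edge.
Qed.

Lemma mixed_after_path o u p : mixed_after o u p -> path (@step G) u p.
Proof.
elim: p o u => //= v p IHp o u /andP[uv /IHp ->]; rewrite andbT.
by case/orP: uv => [/andP[uv _]|uv]; rewrite /step /= uv ?orbT.
Qed.

Lemma mixed_after_nonbacktracking o u p :
  mixed_after o u p -> nonbacktracking (u :: p).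
Proof.
move=> up; apply/forallP=> x; apply/forallP=> y; apply/implyP.
elim: p o u up => [|v p IHp] o u.
  by move=> _ /size_infix.
move=> /= /andP[_ vp] /orP[|xyx]; last exact: IHp vp xyx.
move=> /and3P[/eqP xu /eqP yv].
case: p vp {IHp} => [|w p] //=; rewrite -xu -yv.
move=> /andP[st _] /andP[/eqP xw _]; apply/negP=> xy.
move: st; rewrite /step_after /edge_source xy -xw eqxx andbF /=.
by apply/negP/edge_arcN; rewrite edge_sym.
Qed.

Lemma mixed_after_mixed_path u p :
  mixed_after None u p -> mixed_path u p (last u p).
Proof.
move=> up; rewrite /mixed_path /walk eqxx andbT.
by rewrite (mixed_after_path up) (mixed_after_nonbacktracking up).
Qed.

Lemma geodetic_ends k u p q : geodetic G k ->
  mixed_after None u p -> mixed_after None u q ->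
  size p <= k -> size q <= k -> last u p = last u q -> p = q.
Proof.
move=> geoG up uq ple qle epq; apply: (geoG u (last u p)) => //.
  exact: mixed_after_mixed_path.
by rewrite epq; exact: mixed_after_mixed_path.
Qed.

(** * Counting mixed paths *)

Fixpoint mixed_paths o u s : seq (seq G) :=
  if s is s'.+1 then
    [seq v :: p | v <- enum (step_after o u),
                  p <- mixed_paths (edge_source u v) v s']
  else [:: [::]].

Lemma mem_mixed_paths o u s p :
  (p \in mixed_paths o u s) = mixed_after o u p && (size p == s).
Proof.
elim: s o u p => [|s IHs] o u p /=.
  by rewrite inE; case: p => //= v p; rewrite andbF.
apply/allpairsPdep/andP => [[v [q []]]|].
  rewrite mem_enum IHs => uv /andP[vq sq] ->; split; last exact: sq.
  by apply/andP; split.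
case: p => [|v p] [] // /andP[uv vp] sp.
by exists v, p; split; rewrite ?mem_enum ?IHs //; apply/andP; split.
Qed.

Lemma mixed_paths_uniq o u s : uniq (mixed_paths o u s).
Proof.
elim: s o u => [//|s IHs] o u /=; apply: allpairs_uniq_dep => //.
- exact: enum_uniq.
- by move=> [v p] [w q] _ _ [-> ->].
Qed.

(** In a totally regular graph, the first component counts the mixed
    continuations of length s of a walk that has just used an edge, hence has
    r - 1 edges left to leave by; the second counts those of a walk that has
    just used an arc or has not started. *)
Fixpoint continuations (r z s : nat) : nat * nat :=
  if s is s'.+1 then
    let: (f, g) := continuations r z s' in (r.-1 * f + z * g, r * f + z * g)
  else (1, 1).

Section Regular.
Variables r z : nat.
Hypothesis udegG : forall u, udeg u = r.
Hypothesis outdegG : forall u, outdeg u = z.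

(** The two sums do not overlap, since no edge is parallel to an arc. *)
Lemma sum_steps (F : G -> nat) o u :
  \sum_(v <- enum (step_after o u)) F v
  = \sum_(v | edge u v && (o != Some v)) F v + \sum_(v | arc u v) F v.
Proof.
rewrite big_enum /= (bigID (arc u)) /= addnC.
congr (_ + _); apply: eq_bigl => v.
  rewrite unfold_in /step_after; case: (boolP (edge u v)) => [/edge_arcN|].
    by case: (arc u v) => //; rewrite orbF andbT.
  by case: (arc u v).
by rewrite unfold_in /step_after; case: (arc u v); rewrite ?andbF // orbT.
Qed.

Lemma size_mixed_paths s u :
  size (mixed_paths None u s) = (continuations r z s).2
  /\ forall w, edge w u ->
       size (mixed_paths (Some w) u s) = (continuations r z s).1.
Proof.
elim: s u => [//|s IHs] u /=.
case: (continuations r z s) IHs => f g /= IHs.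
have sizeE o : size [seq v :: p | v <- enum (step_after o u),
      p <- mixed_paths (edge_source u v) v s]
    = #|[set v | edge u v && (o != Some v)]| * f + z * g.
  rewrite size_allpairs_dep sumnE big_map sum_steps.
  rewrite (eq_bigr (fun=> f)); last first.
    move=> v /andP[uv _]; rewrite /edge_source uv.
    exact: (proj2 (IHs v)).
  rewrite sum_nat_const cardsE; congr (_ + _).
  rewrite (eq_bigr (fun=> g)); last first.
    by move=> v uv; rewrite edge_source_arc //; exact: (proj1 (IHs v)).
  by rewrite sum_nat_const -(outdegG u) /outdeg cardsE.
split=> [|w wu]; rewrite sizeE; congr (_ * _ + _).
  by rewrite -(udegG u) /udeg; apply: eq_card => v; rewrite !inE andbT.
have uw : w \in [set v | edge u v] by rewrite inE edge_sym.
rewrite -(udegG u) /udeg [in RHS](cardsD1 w) uw add1n /=.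
apply: eq_card => v; rewrite !inE andbC; congr (_ && _).
by rewrite eq_sym.
Qed.

Lemma size_mixed_pathsN s u :
  size (mixed_paths None u s) = (continuations r z s).2.
Proof. by case: (size_mixed_paths s u). Qed.

Lemma size_mixed_paths_edge s w u : edge w u ->
  size (mixed_paths (Some w) u s) = (continuations r z s).1.
Proof. by case: (size_mixed_paths s u) => _; apply. Qed.

End Regular.

Definition paths_below o u n : seq (seq G) :=
  [seq p | s <- iota 0 n, p <- mixed_paths o u s].

Lemma mem_paths_below o u n p :
  (p \in paths_below o u n) = mixed_after o u p && (size p < n).
Proof.
apply/allpairsPdep/andP => [[s [q []]]|[up pn]].
  by rewrite mem_iota mem_mixed_paths => /= sn /andP[uq /eqP qs] ->; rewrite qs.
by exists (size p), p; rewrite mem_iota mem_mixed_paths up eqxx.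
Qed.

Lemma paths_below_uniq o u n : uniq (paths_below o u n).
Proof.
apply: allpairs_uniq_dep; first exact: iota_uniq.
  by move=> s _; apply: mixed_paths_uniq.
move=> _ _ /allpairsPdep[s [p [_ + ->]]] /allpairsPdep[t [q [_ + ->]]] /= pq.
by rewrite -{q}pq !mem_mixed_paths => /andP[_ /eqP <-] /andP[_ /eqP <-].
Qed.

Lemma size_paths_below o u n :
  size (paths_below o u n) = \sum_(s < n) size (mixed_paths o u s).
Proof.
rewrite size_allpairs_dep sumnE big_map.
rewrite -(big_mkord xpredT (fun s => size (mixed_paths o u s))).
by rewrite /index_iota subn0.
Qed.

Definition reach k v : {set G} :=
  [set x in [seq last v p | p <- paths_below None v k.+1]].

Lemma reachP k v x :
  reflect (exists p, [/\ mixed_after None v p, size p <= k & last v p = x])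
          (x \in reach k v).
Proof.
rewrite inE; apply: (iffP mapP) => [[p + ->]|[p [vp pk <-]]].
  by rewrite mem_paths_below => /andP[vp pk]; exists p.
by exists p; rewrite // mem_paths_below vp.
Qed.

(** Geodecity lets paths be counted by their ends: this turns every path count
    into the cardinal of a vertex set. *)
Lemma card_ends k u (L : seq (seq G)) : geodetic G k -> uniq L ->
  (forall p, p \in L -> mixed_after None u p && (size p <= k)) ->
  #|[set x in [seq last u p | p <- L]]| = size L.
Proof.
move=> geoG uL LP; rewrite cardsE.
have /card_uniqP -> : uniq [seq last u p | p <- L]; last by rewrite size_map.
rewrite map_inj_in_uniq // => p q /LP/andP[up ple] /LP/andP[uq qle].
exact: (geodetic_ends geoG up uq ple qle).
Qed.

(** * Vertices missed by an out-neighbour *)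

(** If every out-neighbour [v] of [u] reached [x], the last vertices before [x]
    on these paths would be distinct in-neighbours of [x], all different from
    the end of [q], which is one in-neighbour too many. *)
Lemma arc_child_unreached k u a q x : geodetic G k ->
  edge u a -> mixed_after (Some u) a q -> (size q).+3 <= k ->
  arc (last a q) x -> indeg x <= outdeg u ->
  exists2 v, arc u v & x \notin reach k v.
Proof.
move=> geoG ua aq qk yx degx.
have uq : mixed_after None u (a :: q) by exact: mixed_after_cons_edge.
have arc_first v p : arc u v -> mixed_after None v p ->
    mixed_after None u (v :: p).
  exact: mixed_after_cons_arc.
have Nua v : arc u v -> a <> v.
  by move=> uv av; have := edge_arcN ua; rewrite av uv.
apply/exists_inP; apply: contraLR degx; rewrite -ltnNge => /exists_inPn reached.
have last_arc v : arc u v -> exists w, [/\ arc w x, w != last a q &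
    exists p, [/\ mixed_after None v p, size p < k & last v p = w]].
  move=> uv; have /negbNE/reachP[p [vp pk px]] := reached v uv.
  have ux : mixed_after None u (a :: rcons q x).
    by rewrite -rcons_cons; apply: mixed_after_rcons_arc.
  case/lastP: p vp pk px => [|p w] vp.
    move=> _ /= vx; case: (Nua v uv).
    have : a :: rcons q x = [:: v].
      apply: (geodetic_ends geoG ux (arc_first v [::] uv isT)) => /=.
      - by rewrite size_rcons ltnW.
      - by apply: leq_trans qk.
      - by rewrite last_rcons.
    by case.
  rewrite size_rcons last_rcons => pk wx; rewrite {w}wx in vp.
  move: vp; rewrite -cats1 mixed_after_cat => /andP[vp /andP[pst _]].
  have uvp := arc_first v p uv vp.
  case/orP: pst => [/andP[wx _]|wx].
    (* leaving x by any edge is legal, as x was entered by an arc *)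
    have uxw : mixed_after None u (a :: rcons (rcons q x) (last v p)).
      rewrite -!rcons_cons; apply: mixed_after_rcons_arc_edge => //.
      by rewrite edge_sym.
    case: (Nua v uv).
    have := geodetic_ends geoG uxw uvp.
    by rewrite /= !size_rcons !last_rcons => /(_ qk pk erefl) [].
  exists (last v p); split=> //; last by exists p.
  apply/eqP=> wy; case: (Nua v uv).
  have := geodetic_ends geoG uq uvp.
  by rewrite /= -wy => /(_ (ltnW (ltnW qk)) pk erefl) [].
(* a choice of the in-neighbour of x through which v reaches x *)
pose via v := [pick w | [&& arc w x, w != last a q & w \in reach k.-1 v]].
have viaP v : arc u v -> exists2 w, via v = Some w &
    [&& arc w x, w != last a q & w \in reach k.-1 v].
  move=> uv; rewrite /via; case: pickP => [w Pw|none]; first by exists w.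
  have [w [wx wy [p [vp pk pw]]]] := last_arc v uv.
  have := none w; rewrite wx wy /= => /negP[]; apply/reachP; exists p.
  by split=> //; rewrite -ltnS prednK // (leq_trans _ qk).
have via_inj : {in [set v | arc u v] &, injective via}.
  move=> v v'; rewrite !inE => uv uv'.
  have [w -> /and3P[_ _ /reachP[p [vp pk pw]]]] := viaP v uv.
  have [w' -> /and3P[_ _ /reachP[p' [vp' pk' pw']]]] := viaP v' uv'.
  case=> ww'; have k0 : 0 < k by rewrite (leq_trans _ qk).
  have := geodetic_ends geoG (arc_first v p uv vp) (arc_first v' p' uv' vp').
  rewrite /= pw pw' ww' -(prednK k0) !ltnS => /(_ pk pk' erefl).
  by case.
rewrite /outdeg -(card_in_imset via_inj) /indeg.
rewrite (cardsD1 (last a q)) inE yx add1n ltnS.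
rewrite -[X in _ <= X](card_imset _ (@Some_inj _)); apply: subset_leq_card.
apply/subsetP=> _ /imsetP[v uv ->]; rewrite inE in uv.
have [w -> /and3P[wx wy _]] := viaP v uv.
by apply: imset_f; rewrite !inE wy.
Qed.

(** * The bound on the excess *)

(** The left-hand side counts the paths of length t + 1 by the nature of their
    last step, the right-hand side by that of their first step.  The two
    agree because the rule for what may follow a step is unchanged when
    paths are reversed. *)
Lemma moore_levelE r z t :
  moore_level r z t
  = (r * (continuations r z t).1, z * (continuations r z t).2).
Proof.
elim: t => [|t IHt] /=; first by rewrite !muln1.
rewrite IHt; case: (continuations r z t) => f g /=.
by congr pair; ring.
Qed.

Lemma moore_boundE r z k :
  moore_bound r z k = \sum_(t < k.+1) (continuations r z t).2.
Proof.
rewrite /moore_bound big_ord_recl; congr (_ + _); apply: eq_bigr => t _.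
by rewrite moore_levelE /=; case: (continuations r z t).
Qed.

Lemma card_bigcup_le (I T : finType) (P : pred I) (A : I -> {set T}) :
  #|\bigcup_(i | P i) A i| <= \sum_(i | P i) #|A i|.
Proof.
elim/big_rec2: _ => [|i n B _ Bn]; first by rewrite cards0.
by rewrite (leq_trans (leq_card_setU _ _)) // leq_add2l.
Qed.

(** The vertices that end a path made of an edge at [u], at most k - 3 further
    steps and a final arc number z times the sum on the left.  Each is outside
    [reach k v] for some out-neighbour [v] of [u], and these z sets have
    complements of #|G| - M(r,z,k) vertices each. *)
Theorem moore_bound_excess r z k u : geodetic G k -> 0 < z ->
  (forall v : G, [/\ udeg v = r, outdeg v = z & indeg v = z]) ->
  moore_bound r z k + \sum_(t < k - 2) (moore_level r z t).1 <= #|G|.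
Proof.
move=> geoG z0 degG.
have ud v : udeg v = r by case: (degG v).
have od v : outdeg v = z by case: (degG v).
have id v : indeg v = z by case: (degG v).
have card_reach v : #|reach k v| = moore_bound r z k.
  rewrite (card_ends geoG (paths_below_uniq _ _ _)); last first.
    by move=> p; rewrite mem_paths_below.
  rewrite size_paths_below moore_boundE.
  by apply: eq_bigr => s _; apply: size_mixed_pathsN.
(* the paths of length between 1 and k - 2 from u that begin with an edge *)
pose L := [seq a :: q | a <- enum (edge u),
                        q <- paths_below (Some u) a (k - 2)].
have LP p : p \in L -> exists a q, [/\ p = a :: q, edge u a,
    mixed_after (Some u) a q & (size q).+3 <= k].
  case/allpairsPdep=> a [q []]; rewrite mem_enum mem_paths_below.
  by move=> ua /andP[aq qk] ->; exists a, q; split=> //; lia.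
have size_L : size L = \sum_(t < k - 2) (moore_level r z t).1.
  rewrite size_allpairs_dep sumnE big_map big_enum /=.
  rewrite (eq_bigr (fun=> \sum_(t < k - 2) (continuations r z t).1)).
    rewrite sum_nat_const -(cardsE (edge u)) -/(udeg u) ud big_distrr /=.
    by apply: eq_bigr => t _; rewrite moore_levelE.
  move=> a ua; rewrite size_paths_below; apply: eq_bigr => t _.
  exact: size_mixed_paths_edge.
(* their extensions by an arc *)
pose L' := [seq rcons p x | p <- L, x <- enum (arc (last u p))].
have size_L' : size L' = size L * z.
  rewrite size_allpairs_dep sumnE big_map (eq_bigr (fun=> z)).
    by rewrite big_const_seq count_predT iter_addn_0 mulnC.
  by move=> p _; rewrite -(od (last u p)) -cardE /outdeg cardsE.
have uniq_L' : uniq L'.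
  apply: allpairs_uniq_dep.
  - apply: allpairs_uniq_dep; first exact: enum_uniq.
    + by move=> a _; apply: paths_below_uniq.
    + by move=> [a q] [b t] _ _ [-> ->].
  - by move=> p _; apply: enum_uniq.
  - by move=> [p x] [q y] _ _ /= /rcons_inj[-> ->].
pose X := [set x in [seq last u p | p <- L']].
have L'P p' : p' \in L' -> exists p x, [/\ p \in L, arc (last u p) x
                                          & p' = rcons p x].
  by case/allpairsPdep=> p [x []]; rewrite mem_enum => *; exists p, x.
have card_X : #|X| = size L * z.
  rewrite -size_L'; apply: (card_ends geoG uniq_L') => _ /L'P[p [x [pL px ->]]].
  have [a [q [ep ua aq qk]]] := LP p pL; rewrite ep in px *.
  by rewrite mixed_after_rcons_arc ?mixed_after_cons_edge //= size_rcons ltnW.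
have subX : X \subset \bigcup_(v | arc u v) ~: reach k v.
  apply/subsetP=> x; rewrite inE => /mapP[_ /L'P[p [y [pL py ->]]]].
  rewrite last_rcons => -> {x}; have [a [q [ep ua aq qk]]] := LP p pL.
  rewrite ep /= in py.
  have [|v uv vy] := arc_child_unreached geoG ua aq qk py.
    by rewrite od id.
  by apply/bigcupP; exists v; rewrite // inE.
have := leq_trans (subset_leq_card subX) (card_bigcup_le _ _).
rewrite card_X (eq_bigr (fun=> #|G| - moore_bound r z k)); last first.
  by move=> v _; rewrite cardsCs setCK card_reach.
rewrite sum_nat_const -cardsE -/(outdeg u) od size_L mulnC leq_pmul2l //.
have := max_card (reach k u); rewrite card_reach; lia.
Qed.

End MixedPaths.

(** * Closed form *)

(** Induction on s, since each root satisfies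
    l ^+ (s + 2) = (r + z - 1) l ^+ (s + 1) + z l ^+ s; the two components
    have to be followed together. *)
Lemma continuations_binet (R : comPzRingType) (r z : nat) (l1 l2 : R) (s : nat) :
  (0 < r)%N ->
  l1 ^+ 2 = (r%:R + z%:R - 1) * l1 + z%:R ->
  l2 ^+ 2 = (r%:R + z%:R - 1) * l2 + z%:R ->
  let d n := l1 ^+ n - l2 ^+ n in
  (continuations r z s).1%:R * (l1 - l2) = d s.+1
  /\ (continuations r z s).2%:R * (l1 - l2) = d s.+1 + d s.
Proof.
move=> r0 e1 e2 d; rewrite {}/d.
elim: s => [|s] /=; first by split; rewrite mul1r ?expr1 ?expr0 ?subrr ?addr0.
case: (continuations r z s) => f g /= [IHf IHg].
have rP : r.-1%:R = r%:R - 1 :> R by rewrite -subn1 natrB.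
have step (l : R) : l ^+ 2 = (r%:R + z%:R - 1) * l + z%:R ->
    l ^+ s.+2 = (r%:R + z%:R - 1) * l ^+ s.+1 + z%:R * l ^+ s.
  by move=> e; rewrite -[s.+2]addn2 exprD e exprS; ring.
rewrite (step _ e1) (step _ e2) !natrD !natrM rP.
split; rewrite mulrDl -!mulrA IHf IHg; ring.
Qed.

(** The term of exponent 0 is the same in both geometric series, and the others
    give the E_t by [continuations_binet]. *)
Lemma sum_moore_edges (R : numFieldType) (r z n : nat) (phi : R) :
  (0 < r)%N -> (0 < z)%N -> phi != 0 ->
  phi ^+ 2 = (r%:R + z%:R - 1) ^+ 2 + 4 * z%:R ->
  let lambda1 := 2^-1 * (r%:R + z%:R - 1 + phi) in
  let lambda2 := 2^-1 * (r%:R + z%:R - 1 - phi) in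
  r%:R / phi * ((lambda1 ^+ n.+1 - 1) / (lambda1 - 1)
                - (lambda2 ^+ n.+1 - 1) / (lambda2 - 1))
  = (\sum_(t < n) (moore_level r z t).1)%:R.
Proof.
move=> hr hz phi0 phi2 lambda1 lambda2.
have root1 : lambda1 ^+ 2 = (r%:R + z%:R - 1) * lambda1 + z%:R.
  have -> : lambda1 ^+ 2 = 4^-1 * ((r%:R + z%:R - 1) ^+ 2
     + 2 * (r%:R + z%:R - 1) * phi + phi ^+ 2) by rewrite /lambda1; field.
  by rewrite phi2 /lambda1; field.
have root2 : lambda2 ^+ 2 = (r%:R + z%:R - 1) * lambda2 + z%:R.
  have -> : lambda2 ^+ 2 = 4^-1 * ((r%:R + z%:R - 1) ^+ 2
     - 2 * (r%:R + z%:R - 1) * phi + phi ^+ 2) by rewrite /lambda2; field.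
  by rewrite phi2 /lambda2; field.
have phiE : lambda1 - lambda2 = phi by rewrite /lambda1 /lambda2; field.
(* l = 1 would give 2 = r + 2z, impossible for r, z >= 1 *)
have neq1 l : l ^+ 2 = (r%:R + z%:R - 1) * l + z%:R :> R -> l - 1 != 0.
  move=> e; apply/eqP=> /subr0_eq l1; move: e; rewrite l1 expr1n mulr1 => e.
  have : 2 = (r + z + z)%:R :> R.
    by rewrite !natrD -[2]/(1 + 1) {1}e; ring.
  by move/eqP; rewrite eqr_nat; lia.
have geom l : l - 1 != 0 ->
    (l ^+ n.+1 - 1) / (l - 1) = \sum_(i < n.+1) l ^+ i :> R.
  by move=> l1; rewrite subrX1 mulrAC mulfV ?mul1r.
rewrite !geom ?neq1 // -sumrB.
rewrite big_ord_recl subrr add0r.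
rewrite (eq_bigr (fun t : 'I_n => (continuations r z t).1%:R * phi));
  last first.
  by move=> t _; rewrite -phiE; case: (continuations_binet t hr root1 root2).
rewrite -mulr_suml [_ * phi]mulrC mulrA divfK // mulr_sumr natr_sum.
by apply: eq_bigr => t _; rewrite moore_levelE natrM.
Qed.

Theorem theorem11 (R : rcfType) (r z k : nat) (eps : int) (G : mixedGraph)
    (hr : (1 <= r)%N) (hz : (1 <= z)%N) (hk : (3 <= k)%N)
    (hG : excess_graph r z k eps G) (hreg : totally_regular G) :
  let phi : R := Num.sqrt ((r%:R + z%:R - 1) ^+ 2 + 4 * z%:R) in
  let lambda1 : R := 2^-1 * (r%:R + z%:R - 1 + phi) in
  let lambda2 : R := 2^-1 * (r%:R + z%:R - 1 - phi) in
  r%:R / phi * ((lambda1 ^+ (k - 1) - 1) / (lambda1 - 1)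
                - (lambda2 ^+ (k - 1) - 1) / (lambda2 - 1)) <= eps%:~R.
Proof.
have [geoG [_ [u0 u0r]] [_ [u1 u1z]] cardG] := hG.
have degG (v : G) : [/\ udeg v = r, outdeg v = z & indeg v = z].
  case: hreg => r' [z' reg]; have [dv ov iv] := reg v.
  have [d0 _ _] := reg u0; have [_ o1 _] := reg u1.
  by split; [rewrite dv -d0|rewrite ov -o1|rewrite iv -o1].
have z0 : 0 < z%:R :> R by rewrite ltr0n.
have phi2_gt0 : 0 < (r%:R + z%:R - 1) ^+ 2 + 4 * z%:R :> R.
  by rewrite ltr_wpDl ?sqr_ge0 // mulr_gt0 ?ltr0n.
have -> : (k - 1 = (k - 2).+1)%N by lia.
rewrite /= sum_moore_edges //; first last.
- by rewrite sqr_sqrtr // ltW.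
- by rewrite sqrtr_eq0 -ltNge.
have excess := moore_bound_excess u0 geoG hz degG.
rewrite -[_%:R]/(_%:Z%:~R) ler_int.
lia.
Qed.
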